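(* Let $T\in V_1\otimes\dots\otimes V_d$ be a tensor and $r\geq 1$. The following are equivalent: (a) the cactus rank of $T$ is at most $r$; (b) there is a finite scheme $Z=\mathrm{Spec}(\mathcal{A})$ with $\deg Z=r$ and a morphism $Z\to\mathrm{Seg}=\mathbb{P}V_1\times\dots\times\mathbb{P}V_d$ such that $T$ lies in the linear span $\langle Z\rangle$; (c) the tensor $T$ is a regular restriction of the multiplication tensor in a Gorenstein algebra $\mathcal{A}'$ with $\dim_k\mathcal{A}'\leq r$. Having $\mathcal{A}$ as in (b), one can choose $\mathcal{A}'$ in (c) to be a quotient algebra of $\mathcal{A}$. In particular, if $\dim_k V_i=r$ for all $i$ and $T$ is concise, then $T$ is isomorphic to the multiplication tensor in $\mathcal{A}$ itself and $\mathcal{A}$ is Gorenstein.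
   Context: $k$ is an arbitrary field, $d\ge3$, $V_1,\dots,V_d$ are finite-dimensional $k$-vector spaces. Algebras are commutative finite-dimensional $k$-algebras; $\deg\mathrm{Spec}(\mathcal{A})=\dim_k\mathcal{A}$. $\mathbb{P}V$ is the space of lines in $V$ and $\mathrm{Seg}\subseteq\mathbb{P}(V_1\otimes\dots\otimes V_d)$ is the Segre variety. Linear span. For a finite scheme $Z$ with a morphism $Z\to\mathrm{Seg}$, $\langle Z\rangle$ is the smallest linear subspace of $V_1\otimes\dots\otimes V_d$ such that $Z\to\mathbb{P}(V_1\otimes\dots\otimes V_d)$ factors scheme-theoretically through $\mathbb{P}\langle Z\rangle$. The cactus rank of $T$ is at most $r$ if there is a finite closed subscheme $Z\subseteq\mathrm{Seg}$ of degree at most $r$ with $T\in\langle Z\rangle$. Multiplication tensor. The ($d$-fold iterated) multiplication tensor of $\mathcal{A}$ is the element of $(\mathcal{A}^\vee)^{\otimes(d-1)}\otimes\mathcal{A}$ corresponding to $(a_1,\dots,a_{d-1})\mapsto a_1\cdots a_{d-1}$. $\mathcal{A}$ is Gorenstein if $\mathcal{A}^\vee=\mathcal{A}\cdot\epsilon$ for some $\epsilon\in\mathcal{A}^\vee$ (a dual generator); then, using the isomorphism $\mathcal{A}\simeq\mathcal{A}^\vee$, $a\mapsto a\epsilon$, the multiplication tensor is identified with the element of $(\mathcal{A}^\vee)^{\otimes d}$ given by $(a_1,\dots,a_d)\mapsto\epsilon(a_1\cdots a_d)$. Restrictions. $T$ is a restriction of $T'\in W_1\otimes\dots\otimes W_d$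 via linear maps $\varphi_i\colon W_i\to V_i$ if $(\varphi_1\otimes\dots\otimes\varphi_d)(T')=T$. A restriction via $\varphi_i\colon\mathcal{A}^\vee\to V_i$ is regular if for each $i$ the map $\mathcal{A}\otimes_k V_i^\vee\to\mathcal{A}$, $a\otimes v\mapsto a\,\varphi_i^\vee(v)$, is surjective, where $\varphi_i^\vee\colon V_i^\vee\to\mathcal{A}$ is the dual map. A tensor is concise if it does not lie in $V_1'\otimes\dots\otimes V_d'$ for subspaces $V_i'\subseteq V_i$ not all equal to $V_i$. Two tensors are isomorphic if linear isomorphisms of the coordinate spaces carry one to the other.
   Formalization: All V_i are assumed nonzero: if some V_i = 0 then Seg is empty and T = 0, so (a) and (c) hold (empty scheme, zero algebra) while (b) fails for every r ≥ 1. *)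

(* Defs.v *)
From HB Require Import structures.
From mathcomp Require Import all_boot all_order all_algebra.

Set Implicit Arguments.
Unset Strict Implicit.
Unset Printing Implicit Defensive.

Import GRing.Theory.
Local Open Scope ring_scope.

(* Commutative finite-dimensional k-algebras.  The library's [lalgType] and its
   descendants exclude the zero ring, which is needed here (the empty scheme, the
   algebra attached to the zero tensor), and Hierarchy Builder does not accept a
   structure joining [comPzRingType] and [vectType] below [lalgType]; hence a
   record whose carrier receives both structures. *)
Record fdAlgType (k : fieldType) := FdAlgType {
  alg_vect : vectType k;
  alg_one : alg_vect;
  alg_mul : alg_vect -> alg_vect -> alg_vect;
  alg_mulA : associative alg_mul;
  alg_mulC : commutative alg_mul;
  alg_mul1 : left_id alg_one alg_mul;
  alg_mulDl : left_distributive alg_mul +%R;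
  alg_scaleAl : forall (c : k) x y, c *: alg_mul x y = alg_mul (c *: x) y
}.

Definition alg_car (k : fieldType) (A : fdAlgType k) : Type := alg_vect A.
Coercion alg_car : fdAlgType >-> Sortclass.

HB.instance Definition _ (k : fieldType) (A : fdAlgType k) :=
  Vector.copy (alg_car A) (alg_vect A).
HB.instance Definition _ (k : fieldType) (A : fdAlgType k) :=
  GRing.Zmodule_isComPzRing.Build (alg_car A)
    (@alg_mulA k A) (@alg_mulC k A) (@alg_mul1 k A) (@alg_mulDl k A).

Notation dual k V := 'Hom(V, (k : fieldType)^o).

(* The isomorphism V -> V^vv, and its inverse. *)
Definition bidual (k : fieldType) (V : vectType k) : 'Hom(V, dual k (dual k V)) :=
  linfun (fun v : V => linfun (fun alpha : dual k V => alpha v)).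

Definition unbidual (k : fieldType) (V : vectType k) : 'Hom(dual k (dual k V), V) :=
  ((bidual V)^-1)%VF.

Section Tensors.
Variables (k : fieldType) (d : nat).
Implicit Types V W : 'I_d -> vectType k.

(* V_1 (x) ... (x) V_d is realised as the space of multilinear forms on
   V_1^v x ... x V_d^v: the pure tensor v_1 (x) ... (x) v_d is the form
   alpha |-> alpha_1(v_1) ... alpha_d(v_d). *)
Definition covectors V : Type := forall i : 'I_d, dual k (V i).

Definition multilinear V (T : covectors V -> k) : Prop :=
  forall (x : covectors V) (i : 'I_d),
    linear (fun u : dual k (V i) => T (dfwith x u) : k^o).

Definition pure_tensor V (v : forall i, V i) : covectors V -> k :=
  fun alpha => \prod_(i < d) alpha i (v i).

(* (phi_1 (x) ... (x) phi_d)(T) *)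
Definition tensor_map W V (phi : forall i, 'Hom(W i, V i))
    (T : covectors W -> k) : covectors V -> k :=
  fun alpha => T (fun i => (alpha i \o phi i)%VF).

(* T belongs to V'_1 (x) ... (x) V'_d. *)
Definition in_subtensor V (V' : forall i, {vspace V i})
    (T : covectors V -> k) : Prop :=
  exists (m : nat) (v : 'I_m -> forall i, V i),
    (forall t i, v t i \in V' i) /\
    (forall alpha, T alpha = \sum_(t < m) pure_tensor (v t) alpha).

Definition concise V (T : covectors V -> k) : Prop :=
  forall V' : forall i, {vspace V i},
    in_subtensor V' T -> forall i, V' i = fullv.

Definition tensor_iso V W (T : covectors V -> k) (T' : covectors W -> k) : Prop :=
  exists f : forall i, 'Hom(V i, W i),
    (forall i, bijective (f i)) /\
    (forall alpha, tensor_map f T alpha = T' alpha).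

Definition tensor_subspace V (U : (covectors V -> k) -> Prop) : Prop :=
  [/\ (forall T, U T -> multilinear T),
      U (fun=> 0)
    & (forall (c : k) T T', U T -> U T' -> U (fun alpha => c * T alpha + T' alpha))].

End Tensors.

Section Schemes.
Variables (k : fieldType) (A : fdAlgType k).

Definition is_ideal (m : {vspace A}) : Prop :=
  forall a x : A, x \in m -> a * x \in m.

Definition is_maximal (m : {vspace A}) : Prop :=
  [/\ is_ideal m, 1 \notin m
    & forall m' : {vspace A}, is_ideal m' -> (m <= m')%VS ->
        1 \notin m' -> m' = m].

(* The free A-module V (x)_k A is realised as Hom_k(V^v, A), with v (x) a
   acting as alpha |-> alpha(v) a.  This is its A-action. *)
Definition amul (V : vectType k) (a : A) (l : 'Hom(dual k V, A)) :
    'Hom(dual k V, A) :=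
  linfun (fun alpha : dual k V => a * l alpha).

Definition is_submodule (V : vectType k) (L : {vspace 'Hom(dual k V, A)}) : Prop :=
  forall (a : A) l, l \in L -> amul a l \in L.

(* Every maximal ideal of A has a neighbourhood D(f) in Spec A over which the
   localisation L_f is free with basis l. *)
Definition is_invertible (V : vectType k) (L : {vspace 'Hom(dual k V, A)}) : Prop :=
  forall m : {vspace A}, is_maximal m ->
    exists f l,
      [/\ f \notin m, l \in L,
          (forall x, x \in L -> exists (N : nat) (a : A), amul (f ^+ N) x = amul a l)
        & (forall a : A, amul a l = 0 -> exists N : nat, f ^+ N * a = 0)].

(* Morphisms Spec A -> PV, by the universal property of the space of lines:
   line subbundles of the trivial bundle V (x) O on Spec A, i.e. invertible
   A-submodules L of V (x) A that are direct summands (the pullbacks of O(-1)). *)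
Definition is_line (V : vectType k) (L : {vspace 'Hom(dual k V, A)}) : Prop :=
  [/\ is_submodule L, is_invertible L
    & exists C, [/\ is_submodule C, (L + C)%VS = fullv & (L :&: C)%VS = 0%VS]].

Variables (d : nat) (V : 'I_d -> vectType k).

Definition line_family : Type := forall i : 'I_d, {vspace 'Hom(dual k (V i), A)}.

(* Morphisms Spec A -> Seg = PV_1 x ... x PV_d. *)
Definition is_morphism (L : line_family) : Prop := forall i, is_line (L i).

Definition sections : Type := forall i : 'I_d, 'Hom(dual k (V i), A).

Definition section_of (L : line_family) (l : sections) : Prop :=
  forall i, l i \in L i.

(* l_1 (x)_A ... (x)_A l_d in (V_1 (x) ... (x) V_d) (x)_k A, viewed as an
   A-valued multilinear form. *)
Definition segre (l : sections) (alpha : covectors V) : A :=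
  \prod_(i < d) l i (alpha i).

(* The composite Spec A -> P(V_1 (x) ... (x) V_d) is the line
   L_1 (x)_A ... (x)_A L_d, generated by the [segre l]; it factors through PU
   iff this line is contained in U (x)_k A. *)
Definition factors_through (L : line_family)
    (U : (covectors V -> k) -> Prop) : Prop :=
  forall l, section_of L l ->
    exists (m : nat) (u : 'I_m -> covectors V -> k) (a : 'I_m -> A),
      (forall t, U (u t)) /\
      (forall alpha, segre l alpha = \sum_(t < m) u t alpha *: a t).

(* T lies in the linear span of Z, the intersection of all such U. *)
Definition in_span (L : line_family) (T : covectors V -> k) : Prop :=
  forall U, tensor_subspace U -> factors_through L U -> U T.

(* The morphism f : Spec A -> Seg given by L is a closed immersion.  Seg is
   covered by the affine charts S_beta = {beta_1 <> 0, ..., beta_d <> 0}, whose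
   regular functions are the F / (beta_1 ... beta_d)^N with F multihomogeneous
   of multidegree (N, ..., N); f is a closed immersion iff O(S_beta) ->
   O(f^-1(S_beta)) is onto for all beta (f is affine).  As Spec A is finite and
   discrete, A -> O(f^-1(S_beta)) is onto, so it is enough to reach every a in
   A, i.e. to have (beta_1 ... beta_d)^N a = F as sections of
   (L_1 (x) ... (x) L_d)^(-N); F is written as a sum of products of linear
   forms, and both sides are evaluated on local sections l of L. *)
Definition is_closed_immersion (L : line_family) : Prop :=
  forall (beta : covectors V) (a : A),
    exists (N m : nat) (c : 'I_m -> k) (F : 'I_m -> 'I_N -> covectors V),
      forall l, section_of L l ->
        segre l beta ^+ N * a = \sum_(t < m) c t *: \prod_(j < N) segre l (F t j).

End Schemes.

Definition cactus_rank_le (k : fieldType) (d : nat) (V : 'I_d -> vectType k)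
    (T : covectors V -> k) (r : nat) : Prop :=
  exists (A : fdAlgType k) (L : line_family A V),
    [/\ is_morphism L, is_closed_immersion L, (\dim {:A} <= r)%N & in_span L T].

Section Algebras.
Variables (k : fieldType) (A : fdAlgType k).

(* A^v = A . eps, where (a . eps)(x) = eps(a x). *)
Definition dual_generator (eps : dual k A) : Prop :=
  forall alpha : dual k A, exists a : A, forall x : A, alpha x = eps (a * x).

Definition gorenstein : Prop := exists eps : dual k A, dual_generator eps.

Variable d : nat.

(* The coordinate spaces of (A^v)^(x)(d-1) (x) A, where A sits at [last]. *)
Definition mul_space (last i : 'I_d) : vectType k :=
  if i == last then A : vectType k else dual k A.

Definition mul_arg (b : bool) :
    dual k (if b then A : vectType k else dual k A) -> A :=
  if b return dual k (if b then A : vectType k else dual k A) -> A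
  then fun=> 1 else fun x => unbidual A x.

Definition mul_out (b : bool) :
    dual k (if b then A : vectType k else dual k A) -> dual k A :=
  if b return dual k (if b then A : vectType k else dual k A) -> dual k A
  then id else fun=> 0.

(* The multiplication tensor, as a form on (A^vv)^(d-1) x A^v: it sends
   (a_1, ..., a_(d-1), alpha) to alpha(a_1 ... a_(d-1)). *)
Definition mul_tensor (last : 'I_d) : covectors (mul_space last) -> k :=
  fun x => mul_out (x last) (\prod_(i < d) mul_arg (x i)).

(* The element of (A^v)^(x)d given by (a_1, ..., a_d) |-> eps(a_1 ... a_d). *)
Definition gorenstein_tensor (eps : dual k A) :
    covectors (fun _ : 'I_d => dual k A : vectType k) -> k :=
  fun x => eps (\prod_(i < d) unbidual A (x i)).

(* phi^v : V^v -> A, using A^vv = A. *)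
Definition dual_map (V : vectType k) (phi : 'Hom(dual k A, V)) : dual k V -> A :=
  fun v => unbidual A (v \o phi)%VF.

Definition regular_map (V : vectType k) (phi : 'Hom(dual k A, V)) : Prop :=
  forall x : A, exists (m : nat) (a : 'I_m -> A) (v : 'I_m -> dual k V),
    x = \sum_(t < m) a t * dual_map phi (v t).

(* A is Gorenstein and T is a regular restriction of its multiplication
   tensor. *)
Definition gorenstein_regular_restriction (V : 'I_d -> vectType k)
    (T : covectors V -> k) : Prop :=
  exists (eps : dual k A) (phi : forall i, 'Hom(dual k A, V i)),
    [/\ dual_generator eps,
        (forall i, regular_map (phi i))
      & (forall alpha, tensor_map phi (gorenstein_tensor eps) alpha = T alpha)].

End Algebras.

Definition is_quotient_algebra (k : fieldType) (A A' : fdAlgType k) : Prop :=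
  exists f : 'Hom(A, A'),
    [/\ f 1 = 1, (forall x y, f (x * y) = f x * f y)
      & forall y, exists x, f x = y].

(* Main.v *)
Require Import Defs.
From mathcomp Require Import all_boot all_order all_algebra.
From HB Require Import structures.
From mathcomp Require Import boolp ring.

(** Over a finite algebra A every line in V (x) A is free: it consists of the
A-multiples of one section l : V^v -> A whose values generate the unit ideal
(l is [unimodular]), and conversely every unimodular l spans a line.  This is
[line_generator] and [unimodular_line].  A morphism Spec A -> Seg is thus a
family of unimodular l_i, and [in_spanP] identifies the linear span: it consists
of the tensors

  T(alpha_1, ..., alpha_d) = eps(l_1(alpha_1) ... l_d(alpha_d))

with eps in A^v.  The predicate [presents l eps T] records such an expression of
T, and everything is a statement about presentations.

A map A^v -> V_i is the transpose of a map V_i^v -> A, and regularity of the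
former is unimodularity of the latter; so a regular restriction of the
multiplication tensor of a Gorenstein algebra is a presentation in which eps is a
dual generator ([gorenstein_regular_restrictionP]).

- From a presentation over A to a Gorenstein one: divide A by the largest ideal
  contained in ker eps.  The quotient is realised as the submodule A.eps of A^v,
  on which eps becomes evaluation at 1 ([presents_gorenstein_quotient]).
- From a presentation of degree at most r to one of degree exactly r: add
  reduced points of Seg, on which the new eps vanishes ([presents_pad]).
- From a presentation over A to one whose morphism is a closed immersion: if the
  morphism is not a closed immersion over the chart S_beta, the elements of A
  that become regular functions on that chart form a proper subalgebra B, and
  after rescaling each l_i by a unit of A the presentation takes place over B
  ([presents_subalgebra]).  Induction on dim A ends with a closed immersion
  ([ex_closed_presentation]).

If T is concise, then the l_i of any presentation are injective
([concise_injective]).  Applied to the Gorenstein quotient of A when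
dim V_i = dim A, this shows that A equals its quotient, hence is Gorenstein with
dual generator eps; the l_i are then isomorphisms, and their transposes carry T
to the multiplication tensor ([tensor_iso_mul_tensor]). *)

Set Implicit Arguments.
Unset Strict Implicit.
Unset Printing Implicit Defensive.

Import GRing.Theory.
Local Open Scope ring_scope.

(** * Linear maps and duality *)

Section LinearAlgebra.
Variable k : fieldType.
Implicit Types V W : vectType k.

Lemma linear_linfunE V W (f : V -> W) : linear f -> linfun f =1 f.
Proof.
move=> lin_f.
pose F : {linear V -> W} :=
  HB.pack f (GRing.isLinear.Build _ _ _ _ f lin_f).
exact: (lfunE F).
Qed.

Lemma lfun0 V W (f : 'Hom(V, W)) : f 0 = 0.
Proof. exact: linear0. Qed.

Lemma lfunB V W (f : 'Hom(V, W)) x y : f (x - y) = f x - f y.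
Proof. exact: linearB. Qed.

Lemma lfunD V W (f : 'Hom(V, W)) x y : f (x + y) = f x + f y.
Proof. exact: linearD. Qed.

Lemma lfunZ V W (f : 'Hom(V, W)) c x : f (c *: x) = c *: f x.
Proof. exact: linearZ. Qed.

Lemma lfun_sum V W (f : 'Hom(V, W)) I (r : seq I) (F : I -> V) :
  f (\sum_(i <- r) F i) = \sum_(i <- r) f (F i).
Proof. exact: linear_sum. Qed.

(** Replaces Noetherian and Zorn-type arguments: maximal ideals, subspaces given
by a predicate and idempotents of maximal rank are all obtained from it. *)
Lemma ex_max_dim V (P : {vspace V} -> Prop) :
    (exists U, P U) ->
  exists2 U, P U & forall W : {vspace V}, P W -> (\dim W <= \dim U)%N.
Proof.
case=> U PU; have [n] := ubnP (\dim {:V} - \dim U)%N.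
elim: n U PU => // n IHn U PU ltn.
have [[W [PW ltUW]]|noW] := pselect (exists W : {vspace V}, P W /\ (\dim U < \dim W)%N).
  apply: (IHn W PW); move: (dimvS (subvf W)) => leW.
  by apply: leq_trans (ltn_sub2l _ ltUW) ltn; apply: leq_trans ltUW leW.
exists U => // W PW; rewrite leqNgt; apply/negP => ltUW.
by apply: noW; exists W.
Qed.

(** A subspace of largest dimension inside P contains every x satisfying P, as
it could otherwise be enlarged by the line through x. *)
Lemma ex_vspace_of_pred V (P : V -> Prop) :
    P 0 -> (forall c x y, P x -> P y -> P (c *: x + y)) ->
  exists U : {vspace V}, forall x, x \in U <-> P x.
Proof.
move=> P0 Plin.
have [|U PU maxU] := @ex_max_dim V (fun U => forall x, x \in U -> P x).
  by exists 0%VS => x; rewrite memv0 => /eqP ->.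
exists U => x; split=> [|Px]; first exact: PU.
suff /eqP -> : U == (U + <[x]>)%VS by apply: (subvP (addvSr _ _)); apply: memv_line.
rewrite eqEdim addvSl; apply: maxU => _ /memv_addP[u Uu [_ /vlineP[c ->] ->]].
by rewrite addrC; apply: Plin => //; apply: PU.
Qed.

Lemma bidualE V (v : V) (alpha : dual k V) : bidual V v alpha = alpha v.
Proof.
have lin v' : linear (fun a : dual k V => a v').
  by move=> c a b; rewrite add_lfunE scale_lfunE.
rewrite linear_linfunE ?linear_linfunE // => c x y.
by apply/lfunP => a; rewrite add_lfunE scale_lfunE !linear_linfunE // linearP.
Qed.

Lemma coord_vbasisE V (v : V) :
  v = \sum_(i < \dim {:V}) coord (vbasis {:V}) i v *: (vbasis {:V})`_i.
Proof. exact: coord_vbasis (memvf v). Qed.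

Lemma linear_coord V n (X : n.-tuple V) i : linear (coord X i : V -> k^o).
Proof. by move=> c x y; rewrite linearP. Qed.

Lemma dual_dim V : \dim {:dual k V} = \dim {:V}.
Proof. by rewrite !dimvf /dim /= muln1. Qed.

Lemma dual_separates V (v : V) : (forall alpha : dual k V, alpha v = 0) -> v = 0.
Proof.
move=> v0; rewrite (coord_vbasisE v) big1 // => i _.
have := v0 (linfun (coord (vbasis {:V}) i : V -> k^o)).
by rewrite linear_linfunE; [move->; rewrite scale0r | exact: linear_coord].
Qed.

Lemma inj_lfun_bij V W (f : 'Hom(V, W)) :
  injective f -> (\dim {:W} <= \dim {:V})%N -> bijective f.
Proof.
move=> inj_f leWV; have ker0 : lker f == 0%VS by apply/lker0P.
exists (f^-1)%VF; first exact: lker0_lfunK.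
suff imf : limg f = fullv by move=> y; apply: limg_lfunVK; rewrite imf memvf.
apply/eqP; rewrite eqEdim subvf limg_dim_eq // (eqP ker0); exact: capv0.
Qed.

Lemma inv_lfun_bij V W (f : 'Hom(V, W)) :
  bijective f -> cancel f (f^-1)%VF /\ cancel (f^-1)%VF f.
Proof.
move=> bij_f; have fK : cancel f (f^-1)%VF by apply/lker0_lfunK/lker0P/bij_inj/bij_f.
by split=> //; apply/bij_can_sym.
Qed.

Lemma surj_lfun_dim V W (f : 'Hom(V, W)) :
  (forall y, exists x, f x = y) -> limg f = fullv.
Proof.
move=> surj_f; apply/vspaceP => y; rewrite memvf.
by have [x <-] := surj_f y; rewrite memv_img ?memvf.
Qed.

Lemma surj_lfun_inj V W (f : 'Hom(V, W)) :
  (forall y, exists x, f x = y) -> (\dim {:V} <= \dim {:W})%N -> injective f.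
Proof.
move=> surj_f leVW; apply/lker0P; rewrite -dimv_eq0 -leqn0.
rewrite -(leq_add2r (\dim {:W})) add0n -{1}(surj_lfun_dim surj_f).
by rewrite -[lker f]capfv limg_ker_dim.
Qed.

Lemma bidual_bij V : bijective (bidual V).
Proof.
apply: inj_lfun_bij; last by rewrite !dual_dim.
move=> x y exy; apply/eqP; rewrite -subr_eq0; apply/eqP/dual_separates => a.
by rewrite lfunB -(bidualE x a) -(bidualE y a) exy subrr.
Qed.

Lemma bidualK V : cancel (bidual V) (unbidual V).
Proof. by apply: lker0_lfunK; apply/lker0P/bij_inj/bidual_bij. Qed.

Lemma unbidualK V : cancel (unbidual V) (bidual V).
Proof.
by apply/bij_can_sym; [exact: bidual_bij | exact: bidualK].
Qed.

(** Since V is reflexive, every linear map between the duals is a transpose; the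
value of f at v is the element of W^vv given by alpha |-> h(alpha)(v). *)
Lemma ex_transpose V W (h : 'Hom(dual k W, dual k V)) :
  exists f : 'Hom(V, W),
    (forall alpha, (alpha \o f)%VF = h alpha) /\ (bijective h -> bijective f).
Proof.
have lin v : linear (fun alpha : dual k W => h alpha v).
  by move=> c x y; rewrite linearP add_lfunE scale_lfunE.
pose ev v : dual k (dual k W) := linfun (fun alpha : dual k W => h alpha v).
have evE v alpha : ev v alpha = h alpha v by rewrite linear_linfunE.
have linf : linear (fun v => unbidual W (ev v)).
  move=> c x y; rewrite -linearP; congr (unbidual W _); apply/lfunP => a.
  by rewrite add_lfunE scale_lfunE !evE linearP.
have fE alpha : (alpha \o linfun (fun v => unbidual W (ev v)))%VF = h alpha.
  apply/lfunP => v; rewrite comp_lfunE linear_linfunE //.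
  by rewrite -(bidualE _ alpha) unbidualK evE.
exists (linfun (fun v => unbidual W (ev v))); split=> // bij_h.
have [g hK gK] := bij_h.
apply: inj_lfun_bij => [x y exy|].
  apply/eqP; rewrite -subr_eq0; apply/eqP/dual_separates => a.
  by rewrite -(gK a) -fE comp_lfunE lfunB exy subrr lfun0.
rewrite -(dual_dim V) -(dual_dim W).
have ker0 : lker h == 0%VS by apply/lker0P/bij_inj/bij_h.
have <- : \dim (limg h) = \dim {:dual k W}.
  by apply: limg_dim_eq; rewrite (eqP ker0) capv0.
exact: dimvS (subvf _).
Qed.

End LinearAlgebra.

(** * Lines over a finite algebra *)

Section AlgebraBasics.
Variables (k : fieldType) (A : fdAlgType k).
Implicit Types (a b c e f : A) (V : vectType k).

Lemma scale_mull (t : k) (x y : A) : t *: (x * y) = (t *: x) * y.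
Proof. exact: (@alg_scaleAl k A). Qed.

Lemma scale_mulr (t : k) (x y : A) : t *: (x * y) = x * (t *: y).
Proof. by rewrite mulrC scale_mull mulrC. Qed.

Definition mulL a : 'Hom(A, A) := linfun (fun x : A => a * x).

Lemma mulLE a (x : A) : mulL a x = a * x.
Proof.
by rewrite linear_linfunE // => c u v; rewrite mulrDr scale_mulr.
Qed.

Lemma amulE V a (l : 'Hom(dual k V, A)) v : amul a l v = a * l v.
Proof.
rewrite linear_linfunE // => c u w.
by rewrite lfunD lfunZ mulrDr scale_mulr.
Qed.

Lemma amulA V a b (l : 'Hom(dual k V, A)) : amul a (amul b l) = amul (a * b) l.
Proof. by apply/lfunP => v; rewrite !amulE mulrA. Qed.

Lemma amul1 V (l : 'Hom(dual k V, A)) : amul 1 l = l.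
Proof. by apply/lfunP => v; rewrite !amulE mul1r. Qed.

Lemma amul0 V (l : 'Hom(dual k V, A)) : amul 0 l = 0.
Proof. by apply/lfunP => v; rewrite !amulE mul0r zero_lfunE. Qed.

Lemma amulD V a b (l : 'Hom(dual k V, A)) : amul (a + b) l = amul a l + amul b l.
Proof. by apply/lfunP => v; rewrite add_lfunE !amulE mulrDl. Qed.

Lemma amulDr V a (l m : 'Hom(dual k V, A)) : amul a (l + m) = amul a l + amul a m.
Proof. by apply/lfunP => v; rewrite !(add_lfunE, amulE) mulrDr. Qed.

Lemma amulZ V (t : k) a (l : 'Hom(dual k V, A)) : amul (t *: a) l = t *: amul a l.
Proof. by apply/lfunP => v; rewrite scale_lfunE !amulE scale_mull. Qed.

(** Fitting's decomposition of A along f: f is invertible on eA, with inverse ew,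
and nilpotent on (1 - e)A.  It exists because the ideals f^n A, for n doubled
repeatedly, cannot shrink forever; once f^n A = f^(2n) A, write f^n = f^(2n) t
and take e = f^n t. *)
Lemma fitting_idempotent f : exists e w n,
  [/\ e * e = e, e = f * w & f ^+ n * e = f ^+ n].
Proof.
have [n] : exists n, (0 < n)%N by exists 1%N.
have [m] := ubnP (\dim (limg (mulL (f ^+ n)))).
elim: m n => // m IHm n ltm n_gt0.
have sub2n : (limg (mulL (f ^+ (n + n))) <= limg (mulL (f ^+ n)))%VS.
  apply/subvP => _ /memv_imgP[x _ ->].
  by rewrite mulLE exprD -mulrA -mulLE memv_img ?memvf.
have [eq2n|ne2n] := eqVneq (limg (mulL (f ^+ (n + n)))) (limg (mulL (f ^+ n))).
  have : f ^+ n \in limg (mulL (f ^+ n)).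
    by rewrite -[X in X \in _]mulr1 -mulLE memv_img ?memvf.
  rewrite -eq2n => /memv_imgP[t _]; rewrite mulLE exprD => fn.
  exists (f ^+ n * t), (f ^+ n.-1 * t), n; split.
  - by rewrite mulrACA mulrA -fn.
  - by rewrite mulrA -exprS (prednK n_gt0).
  - by rewrite mulrA -fn.
apply: (IHm (n + n)%N); last by rewrite addn_gt0 n_gt0.
apply: leq_trans (ltm : (_ <= m)%N).
by rewrite (ltn_leqif (dimv_leqif_eq sub2n)).
Qed.

Lemma ex_maximal (I : {vspace A}) : is_ideal I -> 1 \notin I ->
  exists2 m, is_maximal m & (I <= m)%VS.
Proof.
move=> idI I1.
pose P (W : {vspace A}) := [/\ is_ideal W, (I <= W)%VS & 1 \notin W].
have [|m [idm Im m1] maxm] := @ex_max_dim k A P; first by exists I.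
exists m => //; split=> // m' idm' mm' m'1.
by apply/esym/eqP; rewrite eqEdim mm' maxm //; split=> //; apply: subv_trans mm'.
Qed.

Lemma maximal_prime (m : {vspace A}) f g :
  is_maximal m -> f * g \in m -> f \notin m -> g \in m.
Proof.
move=> [idm m1 maxm] fgm fm.
have memP x : reflect (exists2 y, y \in m & exists a, x = y + f * a)
                (x \in (m + limg (mulL f))%VS).
  apply: (iffP memv_addP) => [[y ym [_ /memv_imgP[a _ ->] ->]]|[y ym [a ->]]].
    by exists y => //; exists a; rewrite mulLE.
  by exists y => //; exists (f * a); rewrite -?mulLE ?memv_img ?memvf.
have idmf : is_ideal (m + limg (mulL f))%VS.
  move=> a _ /memP[y ym [b ->]]; apply/memP; exists (a * y); first exact: idm.
  by exists (a * b); ring.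
have [/memP[y ym [a e1]]|n1] := boolP (1 \in (m + limg (mulL f))%VS).
  have -> : g = g * y + a * (f * g) by rewrite -[LHS]mulr1 e1; ring.
  by apply: memvD; apply: idm.
have emf := maxm _ idmf (addvSl _ _) n1.
case/negP: fm; rewrite -emf; apply/memP; exists 0; first exact: mem0v.
by exists 1; rewrite add0r mulr1.
Qed.

Definition unimodular V (l : 'Hom(dual k V, A)) : Prop :=
  exists s : seq (A * dual k V), \sum_(p <- s) p.1 * l p.2 = 1.

Definition generates V (L : {vspace 'Hom(dual k V, A)}) l : Prop :=
  l \in L /\ forall x, x \in L -> exists a, x = amul a l.

(** L becomes free of rank one, with basis e.l, over the factor eA of A. *)
Definition splits_at V (L : {vspace 'Hom(dual k V, A)}) e : Prop :=
  e * e = e /\ exists2 l, l \in L &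
    (forall x, x \in L -> exists a, amul e x = amul a l)
    /\ (forall a, amul a l = 0 -> e * a = 0).

(** Invertibility makes L free over the open set D(f), for some f outside m; as
A is finite, D(f) is also closed, the spectrum of the factor eA given by Fitting's
idempotent of f. *)
Lemma splits_at_local V (L : {vspace 'Hom(dual k V, A)}) m :
  is_invertible L -> is_maximal m -> exists2 e, e \notin m & splits_at L e.
Proof.
move=> invL maxm; have [f [l [fm lL gen_l reg_l]]] := invL m maxm.
have [e [w [n [ee ew fe]]]] := fitting_idempotent f.
have eX j : e = w ^+ j * e * f ^+ j.
  elim: j => [|j IHj]; first by rewrite !expr0 mul1r mulr1.
  by rewrite -{1}ee {1}IHj {1}ew !exprS; ring.
exists e.
  apply/negP => em; have [idm m1 _] := maxm.
  have: f ^+ n \in m by rewrite -fe idm.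
  elim: n {fe} => [|n IHn]; first by rewrite expr0 (negPf m1).
  by rewrite exprS => /(maximal_prime maxm)/(_ fm).
split=> //; exists l => //; split=> [x xL|a al0].
  have [j [a fx]] := gen_l x xL.
  by exists (w ^+ j * e * a); rewrite [in LHS](eX j) -amulA fx amulA.
by have [j fa] := reg_l a al0; rewrite (eX j) -mulrA fa mulr0.
Qed.

(** The idempotents e1 and g = (1 - e1) e2 are orthogonal, so L is free on the
union of their open sets, with basis the sum of the two local ones. *)
Lemma splits_at_join V (L : {vspace 'Hom(dual k V, A)}) e1 e2 :
  is_submodule L -> splits_at L e1 -> splits_at L e2 ->
  splits_at L (e1 + (1 - e1) * e2).
Proof.
move=> subL [ee1 [l1 l1L [gen1 reg1]]] [ee2 [l2 l2L [gen2 reg2]]].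
have e10 : e1 * (1 - e1) = 0 by rewrite mulrBr mulr1 ee1 subrr.
set g := (1 - e1) * e2.
have gg : g * g = g.
  have -> : g * g = (1 - e1) * (1 - e1) * (e2 * e2) by rewrite /g; ring.
  by rewrite ee2 mulrBl e10 subr0 mul1r.
have eg : e1 * g = 0 by rewrite mulrA e10 mul0r.
split; first by rewrite mulrDl !mulrDr ee1 gg eg mulrC eg addr0 add0r.
exists (amul e1 l1 + amul g l2); first by apply: memvD; apply: subL.
split=> [x xL|a].
  have [a1 x1] := gen1 x xL; have [a2 x2] := gen2 x xL.
  exists (e1 * a1 + g * a2).
  rewrite amulDr !amulA amulD.
  have -> : (e1 * a1 + g * a2) * e1 = e1 * a1.
    have -> : (e1 * a1 + g * a2) * e1 = e1 * e1 * a1 + (e1 * g) * a2 by ring.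
    by rewrite ee1 eg mul0r addr0.
  have -> : (e1 * a1 + g * a2) * g = g * a2.
    have -> : (e1 * a1 + g * a2) * g = (e1 * g) * a1 + g * g * a2 by ring.
    by rewrite gg eg mul0r add0r.
  rewrite -amulA -x1 amulA ee1; congr (_ + _).
  have -> : g * a2 = g * e2 * a2 by rewrite -[g * e2]mulrA ee2.
  by rewrite -!amulA -x2 !amulA -mulrA ee2 -[g * e2]mulrA ee2.
rewrite amulDr !amulA => al0; rewrite mulrDl.
have al1 : amul (e1 * a) l1 = 0.
  have := congr1 (amul e1) al0; rewrite amulDr !amulA.
  have -> : e1 * (a * e1) = e1 * e1 * a by ring.
  have -> : e1 * (a * g) = e1 * g * a by ring.
  rewrite ee1 eg mul0r amul0 addr0 => ->.
  by apply/lfunP => v; rewrite amulE zero_lfunE mulr0.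
have al2 : amul (g * a) l2 = 0.
  have := congr1 (amul g) al0; rewrite amulDr !amulA.
  have -> : g * (a * e1) = e1 * g * a by ring.
  have -> : g * (a * g) = g * g * a by ring.
  rewrite gg eg mul0r amul0 add0r => ->.
  by apply/lfunP => v; rewrite amulE zero_lfunE mulr0.
have := reg1 _ al1; rewrite mulrA ee1 => ->.
have := reg2 _ al2; rewrite !mulrA [e2 * _]mulrC -[_ * e2 * e2]mulrA ee2 => ->.
by rewrite addr0.
Qed.

(** Take e with eA of largest dimension such that L is free over eA.  If e were
not 1, then eA would lie in a maximal ideal m, and joining to e an idempotent
outside m over which L is free would enlarge eA. *)
Lemma invertible_free V (L : {vspace 'Hom(dual k V, A)}) :
    is_submodule L -> is_invertible L ->
  exists2 l, generates L l & forall a, amul a l = 0 -> a = 0.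
Proof.
move=> subL invL.
pose P (W : {vspace A}) := exists2 e, splits_at L e & W = limg (mulL e).
have [|_ [e se ->] maxe] := @ex_max_dim k A P.
  exists (limg (mulL 0)), 0 => //; split; first by rewrite mul0r.
  exists 0; first exact: mem0v.
  split=> [x xL|a _]; last by rewrite mul0r.
  by exists 0; rewrite !amul0.
have idI : is_ideal (limg (mulL e)).
  move=> a _ /memv_imgP[x _ ->]; rewrite mulLE mulrCA -mulLE.
  exact: memv_img (memvf _).
have [e1|ne1] := boolP (1 \in limg (mulL e)).
  have [ee [l lL [gen reg]]] := se.
  have {}e1: e = 1.
    case/memv_imgP: e1 => x _; rewrite mulLE => e1.
    by rewrite -[LHS]mulr1 e1 mulrA ee.
  exists l; first split=> // x xL.
    by have [a] := gen x xL; rewrite e1 amul1; exists a.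
  by move=> a /reg; rewrite e1 mul1r.
have [m maxm em] := ex_maximal idI ne1.
have [f fm sf] := splits_at_local invL maxm.
have [ee _] := se; have sj := splits_at_join subL se sf.
set g := e + (1 - e) * f in sj.
have ge : g * e = e.
  have -> : g * e = e * e + f * (e - e * e) by rewrite /g; ring.
  by rewrite ee subrr mulr0 addr0.
have sub_eg : (limg (mulL e) <= limg (mulL g))%VS.
  apply/subvP => _ /memv_imgP[x _ ->].
  by rewrite mulLE -ge -mulrA -mulLE memv_img ?memvf.
have /eqP : limg (mulL e) == limg (mulL g).
  by rewrite eqEdim sub_eg maxe //; exists g.
move=> eq_eg.
have : g \in limg (mulL e).
  by rewrite eq_eg -[g in X in X \in _]mulr1 -mulLE memv_img ?memvf.
case/memv_imgP=> x _; rewrite mulLE => gx.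
have ge' : g = e by rewrite -ge {2}gx mulrC mulrA ee -gx.
case/negP: fm; apply: (subvP em); have -> : f = e * f.
  apply/eqP; rewrite -subr_eq0 -[X in X - _]mul1r -mulrBl.
  by rewrite -(addKr e (_ * f)) -/g ge' addNr.
by rewrite -mulLE memv_img ?memvf.
Qed.

Definition tensor1 V (v : V) : 'Hom(dual k V, A) :=
  linfun (fun alpha : dual k V => alpha v *: (1 : A)).

Lemma tensor1E V (v : V) alpha : tensor1 v alpha = alpha v *: (1 : A).
Proof.
rewrite linear_linfunE // => c x y.
by rewrite add_lfunE scale_lfunE scalerDl scalerA.
Qed.

Lemma dual_expand V (alpha : dual k V) :
  alpha = \sum_(i < \dim {:V}) alpha (vbasis {:V})`_i *:
     linfun (coord (vbasis {:V}) i : V -> k^o).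
Proof.
apply/lfunP => v; rewrite {1}(coord_vbasisE v) lfun_sum sum_lfunE.
apply: eq_bigr => i _; rewrite lfunZ scale_lfunE linear_linfunE; last exact: linear_coord.
exact: mulrC.
Qed.

Lemma tensor_expand V (l : 'Hom(dual k V, A)) :
  l = \sum_(i < \dim {:V}) amul (l (linfun (coord (vbasis {:V}) i : V -> k^o)))
        (tensor1 (vbasis {:V})`_i).
Proof.
apply/lfunP => alpha; rewrite sum_lfunE {1}(dual_expand alpha) lfun_sum.
apply: eq_bigr => i _.
by rewrite lfunZ amulE tensor1E -scale_mulr mulr1.
Qed.

(** A complement C of L gives unimodularity: expand the generator l in the
standard basis v_i (x) 1 of V (x) A and replace each v_i (x) 1 by its component
c_i.l in L.  Then l = (sum b_i c_i) l, where the b_i are values of l, and l is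
A-free, so sum b_i c_i = 1. *)
Lemma line_generator V (L : {vspace 'Hom(dual k V, A)}) :
  is_line L -> exists2 l, generates L l & unimodular l.
Proof.
move=> [subL invL [C [subC LC LC0]]].
have [l genl reg] := invertible_free subL invL; exists l => //.
have [lL gen] := genl.
have dec v : exists c, tensor1 v - amul c l \in C.
  have : tensor1 v \in (L + C)%VS by rewrite LC memvf.
  case/memv_addP=> x /gen[c ->] [z zC ->]; exists c.
  by rewrite addrC addKr.
have [c cP] := choice dec.
pose b i := l (linfun (coord (vbasis {:V}) i : V -> k^o)).
pose u := \sum_(i < \dim {:V}) b i * c (vbasis {:V})`_i.
exists [seq (c (vbasis {:V})`_i, linfun (coord (vbasis {:V}) i : V -> k^o))
        | i : 'I_(\dim {:V}) <- index_enum 'I_(\dim {:V})].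
rewrite big_map /=; transitivity u; first by apply: eq_bigr => i _; rewrite mulrC.
apply/esym/eqP; rewrite -subr_eq0; apply/eqP/reg.
suff : amul (1 - u) l \in (L :&: C)%VS by rewrite LC0 memv0 => /eqP.
rewrite memv_cap subL //=.
have -> : amul (1 - u) l =
    \sum_(i < \dim {:V}) amul (b i) (tensor1 (vbasis {:V})`_i - amul (c (vbasis {:V})`_i) l).
  apply/lfunP => v; rewrite amulE mulrBl mul1r sum_lfunE.
  rewrite {1}(tensor_expand l) sum_lfunE mulr_suml -sumrB.
  by apply: eq_bigr => i _; rewrite !(amulE, add_lfunE, opp_lfunE) mulrBr mulrA.
by apply: memv_suml => i _; apply: subC; apply: cP.
Qed.

(** If sum c_j l(v_j) = 1, then x |-> sum c_j x(v_j) is an A-linear functional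
rho with rho(l) = 1; hence A.l is free and ker rho is a complement. *)
Lemma unimodular_line V (l : 'Hom(dual k V, A)) :
  unimodular l -> exists2 L, is_line L & generates L l.
Proof.
move=> [s s1].
pose rho (x : 'Hom(dual k V, A)) : A := \sum_(p <- s) p.1 * x p.2.
have rho_lin : linear rho.
  move=> c x y; rewrite /rho scaler_sumr -big_split; apply: eq_bigr => p _.
  by rewrite add_lfunE scale_lfunE mulrDr scale_mulr.
have rhoM a x : rho (amul a x) = a * rho x.
  by rewrite /rho mulr_sumr; apply: eq_bigr => p _; rewrite amulE mulrCA.
pose mul_l (a : A) := amul a l.
have mul_lin : linear mul_l by move=> c x y; rewrite /mul_l amulD amulZ.
pose L := limg (linfun mul_l).
have LP x : reflect (exists a, x = amul a l) (x \in L).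
  apply: (iffP memv_imgP) => [[a _ ->]|[a ->]]; exists a; rewrite ?linear_linfunE //.
  exact: memvf.
have lL : l \in L by apply/LP; exists 1; rewrite amul1.
have subL : is_submodule L.
  by move=> a _ /LP[b ->]; apply/LP; exists (a * b); rewrite amulA.
exists L; last by split=> // x /LP.
split=> //.
  move=> m [_ m1 _]; exists 1, l; split=> // [x /LP[a ->]|a al0].
    by exists 0%N, a; rewrite expr0 amul1.
  exists 0%N; rewrite expr0 mul1r -[a]mulr1 -s1 mulr_sumr big1 // => p _.
  by rewrite mulrCA -amulE al0 zero_lfunE mulr0.
exists (lker (linfun rho)); split.
- by move=> a x; rewrite !memv_ker !linear_linfunE // rhoM => /eqP ->; rewrite mulr0.
- apply/eqP; rewrite eqEsubv subvf /=; apply/subvP => x _.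
  rewrite -[x](subrK (amul (rho x) l)) addrC; apply: memv_add.
    by apply/LP; exists (rho x).
  rewrite memv_ker lfunB !linear_linfunE // rhoM.
  by rewrite [rho l]s1 mulr1 subrr.
apply/eqP; rewrite -subv0; apply/subvP => x.
rewrite memv_cap memv_ker linear_linfunE // => /andP[/LP[a ->]].
by rewrite rhoM [rho l]s1 mulr1 => /eqP->; rewrite amul0 mem0v.
Qed.

End AlgebraBasics.

(** * Linear spans and presentations *)

Section Presentations.
Variables (k : fieldType) (A : fdAlgType k) (d : nat) (V : 'I_d -> vectType k).
Implicit Types (l : sections A V) (eps : dual k A) (T : covectors V -> k).
Implicit Types (L : line_family A V).

(** T is the image under eps of the A-valued point l of the cone over Seg; by
[in_spanP] this says that T lies in the span of the morphism defined by l. *)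
Definition presents l eps T : Prop :=
  (forall i, unimodular (l i)) /\ (forall alpha, T alpha = eps (segre l alpha)).

Lemma segre_dfwith l (x : covectors V) i (u : dual k (V i)) :
  segre l (dfwith x u) = l i u * \prod_(j < d | j != i) l j (x j).
Proof.
rewrite /segre (bigD1 i) //= dfwith_in; congr (_ * _).
by apply: eq_bigr => j ji; rewrite dfwith_out // eq_sym.
Qed.

Lemma segre_amul l (c : 'I_d -> A) (alpha : covectors V) :
  segre (fun i => amul (c i) (l i)) alpha = (\prod_i c i) * segre l alpha.
Proof. by rewrite /segre -big_split; apply: eq_bigr => i _; rewrite amulE. Qed.

(** All sections of the line L_1 (x) ... (x) L_d are multiples of one, so its
properties need only be tested on the generators l_i. *)
Lemma section_scalars L l l' : (forall i, generates (L i) (l i)) ->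
  section_of L l' -> exists c : A, forall alpha, segre l' alpha = c * segre l alpha.
Proof.
move=> genl l'L.
have [c cP] := choice (fun i => (genl i).2 (l' i) (l'L i)).
exists (\prod_i c i) => alpha; rewrite -segre_amul /segre.
by apply: eq_bigr => i _; rewrite cP.
Qed.

Lemma form_multilinear l eps : multilinear (fun alpha => eps (segre l alpha)).
Proof.
move=> x i c u v; rewrite !segre_dfwith lfunD lfunZ.
by rewrite mulrDl -scale_mull lfunD lfunZ.
Qed.

(** The forms eps o segre(l) make up a subspace through which the morphism
factors, as one sees from the coordinates of A; and if segre(l) = sum u_t a_t with
the u_t in U, then eps o segre(l) = sum eps(a_t) u_t lies in U. *)
Lemma in_spanP L l T : (forall i, generates (L i) (l i)) ->
  in_span L T <-> exists eps, forall alpha, T alpha = eps (segre l alpha).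
Proof.
move=> genl; split=> [spanT|[eps TE] U [_ U0 Ulin] factU].
  apply: (spanT (fun T' => exists eps, forall alpha, T' alpha = eps (segre l alpha)));
    last first.
    move=> l' /(section_scalars genl)[c l'E].
    have lin t : linear (fun a : A => coord (vbasis {:A}) t (c * a) : k^o).
      by move=> z x y; rewrite mulrDr -scale_mulr linear_coord.
    exists (\dim {:A}).
    exists (fun t alpha => linfun (fun a : A => coord (vbasis {:A}) t (c * a) : k^o)
                             (segre l alpha)).
    exists (fun t => (vbasis {:A})`_t); split=> [t|alpha]; first by eexists.
    rewrite l'E [LHS]coord_vbasisE; apply: eq_bigr => t _.
    by rewrite linear_linfunE.
  split.
  - move=> T' [eps T'E].
    have -> : T' = fun alpha => eps (segre l alpha) by apply: funext.
    exact: form_multilinear.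
  - by exists 0 => alpha; rewrite zero_lfunE.
  - move=> c T1 T2 [eps1 E1] [eps2 E2]; exists (c *: eps1 + eps2) => alpha.
    by rewrite add_lfunE scale_lfunE E1 E2.
have lL : section_of L l by move=> i; case: (genl i).
have [m [u [a [uU segE]]]] := factU l lL.
have -> : T = fun alpha => \sum_(t < m) eps (a t) * u t alpha.
  apply: funext => alpha; rewrite TE segE lfun_sum.
  by apply: eq_bigr => t _; rewrite lfunZ mulrC.
elim: m u a uU {segE} => [|m IHm] u a uU.
  by have -> : (fun alpha => \sum_(t < 0) eps (a t) * u t alpha) = fun=> 0
    by apply: funext => alpha; rewrite big_ord0.
have -> : (fun alpha => \sum_(t < m.+1) eps (a t) * u t alpha) =
    fun alpha => eps (a ord0) * u ord0 alpha +
      \sum_(t < m) eps (a (lift ord0 t)) * u (lift ord0 t) alpha.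
  by apply: funext => alpha; rewrite big_ord_recl.
by apply: Ulin => //; apply: (IHm (fun t => u (lift ord0 t)) (fun t => a (lift ord0 t))).
Qed.

Lemma presents_of_span L T : is_morphism L -> in_span L T ->
  exists l eps, presents l eps T.
Proof.
move=> morL spanT.
pose l i := projT1 (cid2 (line_generator (morL i))).
have [genl uni] : (forall i, generates (L i) (l i)) /\ (forall i, unimodular (l i)).
  by split=> i; rewrite /l; case: cid2.
have [eps TE] := (in_spanP T genl).1 spanT.
by exists l, eps.
Qed.

Lemma span_of_presents l eps T : presents l eps T ->
  exists L : line_family A V, [/\ is_morphism L, forall i, generates (L i) (l i)
    & in_span L T].
Proof.
move=> [uni TE].
pose L i := projT1 (cid2 (unimodular_line (uni i))).
have [lineL genl] : (forall i, is_line (L i)) /\ (forall i, generates (L i) (l i)).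
  by split=> i; rewrite /L; case: cid2.
by exists L; split=> //; apply/(in_spanP T genl); exists eps.
Qed.

End Presentations.

(** * Image algebras and Gorenstein quotients *)

Section ImageAlgebra.
Variables (k : fieldType) (A : fdAlgType k) (W : vectType k) (pi : 'Hom(A, W)).
Hypothesis pi_surj : forall y, exists x, pi x = y.
Hypothesis ker_ideal : forall a x : A, pi x = 0 -> pi (a * x) = 0.

Definition image_mul (y z : W) : W := pi ((pi^-1)%VF y * (pi^-1)%VF z).

(** The product on W does not depend on the chosen preimages, because ker pi is
an ideal. *)
Lemma image_mulE a b : image_mul (pi a) (pi b) = pi (a * b).
Proof.
have piK c : pi ((pi^-1)%VF (pi c) - c) = 0.
  by rewrite lfunB limg_lfunVK ?subrr // memv_img ?memvf.
apply/eqP; rewrite -subr_eq0 /image_mul -lfunB.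
set a' := (pi^-1)%VF (pi a); set b' := (pi^-1)%VF (pi b).
have -> : a' * b' - a * b = a' * (b' - b) + b * (a' - a) by ring.
by rewrite lfunD !ker_ideal ?piK // addr0.
Qed.

Lemma image_mulA : associative image_mul.
Proof.
move=> x y z; have [[a <-] [b <-] [c <-]] := And3 (pi_surj x) (pi_surj y) (pi_surj z).
by rewrite !image_mulE mulrA.
Qed.

Lemma image_mulC : commutative image_mul.
Proof. by move=> x y; rewrite /image_mul mulrC. Qed.

Lemma image_mul1 : left_id (pi 1) image_mul.
Proof. by move=> x; have [a <-] := pi_surj x; rewrite image_mulE mul1r. Qed.

Lemma image_mulDl : left_distributive image_mul +%R.
Proof. by move=> x y z; rewrite /image_mul lfunD mulrDl lfunD. Qed.

Lemma image_scaleAl c x y : c *: image_mul x y = image_mul (c *: x) y.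
Proof. by rewrite /image_mul lfunZ -scale_mull lfunZ. Qed.

Definition image_alg : fdAlgType k :=
  FdAlgType image_mulA image_mulC image_mul1 image_mulDl image_scaleAl.

End ImageAlgebra.

Section GorensteinQuotient.
Variables (k : fieldType).

(** The A-linear map a |-> a.eps from A to A^v. *)
Definition trace_form (A : fdAlgType k) (eps : dual k A) : 'Hom(A, dual k A) :=
  linfun (fun a : A => linfun (fun x : A => eps (a * x)) : dual k A).

Lemma trace_formE (A : fdAlgType k) (eps : dual k A) a x :
  trace_form eps a x = eps (a * x).
Proof.
have lin a' : linear (fun x' : A => eps (a' * x') : k^o).
  by move=> c u v; rewrite mulrDr -scale_mulr lfunD lfunZ.
rewrite linear_linfunE ?linear_linfunE // => c u v; apply/lfunP => w.
by rewrite add_lfunE scale_lfunE !linear_linfunE // mulrDl -scale_mull lfunD lfunZ.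
Qed.

Lemma nondegenerate_trace_form_bij (A : fdAlgType k) (eps : dual k A) :
  (forall a, (forall x, eps (a * x) = 0) -> a = 0) -> bijective (trace_form eps).
Proof.
move=> nondeg; apply: inj_lfun_bij; last by rewrite dual_dim.
move=> a b eab; apply/eqP; rewrite -subr_eq0; apply/eqP/nondeg => x.
by rewrite -trace_formE lfunB eab subrr zero_lfunE.
Qed.

Lemma nondegenerate_dual_generator (A : fdAlgType k) (eps : dual k A) :
  (forall a, (forall x, eps (a * x) = 0) -> a = 0) -> dual_generator eps.
Proof.
move=> /nondegenerate_trace_form_bij[g _ Kg] alpha.
by exists (g alpha) => x; rewrite -trace_formE Kg.
Qed.

(** If a kills eps, then it is killed by every functional b.eps, that is, by the
whole dual of A. *)
Lemma dual_generator_nondegenerate (A : fdAlgType k) (eps : dual k A) :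
  dual_generator eps -> forall a : A, (forall x : A, eps (a * x) = 0) -> a = 0.
Proof.
move=> gen a a0; apply: dual_separates => alpha.
by have [b ->] := gen alpha; rewrite mulrC a0.
Qed.

(** The kernel of a |-> a.eps is the largest ideal contained in ker eps, so A.eps
is a quotient algebra of A.  Evaluation at 1 maps a.eps to eps(a); it is a
nondegenerate functional on A.eps, because a.eps is zero as soon as every
eps(ax) is. *)
Lemma gorenstein_quotient (A : fdAlgType k) (eps : dual k A) :
  exists (A' : fdAlgType k) (pi : 'Hom(A, A')) (eps' : dual k A'),
  [/\ pi 1 = 1, (forall x y, pi (x * y) = pi x * pi y),
      (forall y, exists x, pi x = y), dual_generator eps'
    & forall x, eps' (pi x) = eps x].
Proof.
set U := limg (trace_form eps).
pose proj (a : A) : subvs_of U := vsproj U (trace_form eps a).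
have lin_proj : linear proj by move=> c x y; rewrite /proj !linearP.
pose pi : 'Hom(A, subvs_of U) := linfun proj.
have piE a : vsval (pi a) = trace_form eps a.
  by rewrite linear_linfunE // vsprojK // memv_img ?memvf.
have pi_surj y : exists x, pi x = y.
  have /memv_imgP[x _ yx] := subvsP y; exists x.
  by apply: subvs_inj; rewrite piE.
have pi0 a : pi a = 0 <-> forall x, eps (a * x) = 0.
  split=> [pa0 x|e0].
    by rewrite -trace_formE -piE pa0 zero_lfunE.
  by apply: subvs_inj; rewrite piE; apply/lfunP => x; rewrite trace_formE e0 zero_lfunE.
have ker_ideal (a x : A) : pi x = 0 -> pi (a * x) = 0.
  by move=> /pi0 x0; apply/pi0 => z; rewrite -mulrA mulrCA x0.
pose A' := image_alg pi_surj ker_ideal.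
have lin_ev : linear (fun w : A' => (vsval (w : subvs_of U) : dual k A) 1 : k^o).
  by move=> c u v; rewrite linearP add_lfunE scale_lfunE.
have piM (x y : A) : (pi (x * y) : A') = (pi x : A') * (pi y : A').
  by rewrite -(image_mulE ker_ideal).
exists A', pi, (linfun (fun w : A' => (vsval (w : subvs_of U) : dual k A) 1 : k^o)).
have evE (x : A) : linfun (fun w : A' => (vsval (w : subvs_of U) : dual k A) 1 : k^o) (pi x)
    = eps x.
  by rewrite (linear_linfunE lin_ev) piE trace_formE mulr1.
split=> //.
apply: nondegenerate_dual_generator => y ynull.
have [a ya] := pi_surj y; rewrite -ya; apply/pi0 => x.
by rewrite -evE piM ya ynull.
Qed.

End GorensteinQuotient.

(** * Subalgebras and products with a point *)

Section Subalgebra.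
Variables (k : fieldType) (A : fdAlgType k) (B : {vspace A}).
Hypothesis B1 : 1 \in B.
Hypothesis BM : forall x y : A, x \in B -> y \in B -> x * y \in B.

Definition sub_mul (x y : subvs_of B) : subvs_of B :=
  vsproj B ((vsval x : A) * (vsval y : A)).

Lemma sub_mulE x y : vsval (sub_mul x y) = (vsval x : A) * (vsval y : A).
Proof. by rewrite vsprojK // BM ?subvsP. Qed.

Lemma sub_mulA : associative sub_mul.
Proof. by move=> x y z; apply: subvs_inj; rewrite !sub_mulE mulrA. Qed.

Lemma sub_mulC : commutative sub_mul.
Proof. by move=> x y; apply: subvs_inj; rewrite !sub_mulE mulrC. Qed.

Lemma sub_mul1 : left_id (vsproj B 1) sub_mul.
Proof. by move=> x; apply: subvs_inj; rewrite !sub_mulE vsprojK // mul1r. Qed.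

Lemma sub_mulDl : left_distributive sub_mul +%R.
Proof. by move=> x y z; apply: subvs_inj; rewrite linearD /= !sub_mulE linearD mulrDl. Qed.

Lemma sub_scaleAl c x y : c *: sub_mul x y = sub_mul (c *: x) y.
Proof.
by apply: subvs_inj; rewrite linearZ /= !sub_mulE linearZ; apply: scale_mull.
Qed.

Definition subalg : fdAlgType k :=
  FdAlgType sub_mulA sub_mulC sub_mul1 sub_mulDl sub_scaleAl.

End Subalgebra.

Section AdjoinPoint.
Variables (k : fieldType) (A : fdAlgType k).

(** The product algebra A x k: its spectrum is Spec A with one reduced rational
point added. *)
Definition adj_mul (x y : (alg_vect A * k^o)%type) : (alg_vect A * k^o)%type :=
  ((x.1 : A) * (y.1 : A), x.2 * y.2).

Lemma adj_mulA : associative adj_mul.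
Proof.
by move=> x y z;
  apply: injective_projections; [exact: (@mulrA A) | exact: (@mulrA k)].
Qed.

Lemma adj_mulC : commutative adj_mul.
Proof.
by move=> x y;
  apply: injective_projections; [exact: (@mulrC A) | exact: (@mulrC k)].
Qed.

Lemma adj_mul1 : left_id ((1 : A) : alg_vect A, 1 : k^o) adj_mul.
Proof.
by case=> x y;
  apply: injective_projections; [exact: (@mul1r A) | exact: (@mul1r k)].
Qed.

Lemma adj_mulDl : left_distributive adj_mul +%R.
Proof.
by move=> x y z;
  apply: injective_projections; [exact: (@mulrDl A) | exact: (@mulrDl k)].
Qed.

Lemma adj_scaleAl c x y : c *: adj_mul x y = adj_mul (c *: x) y.
Proof.
by apply: injective_projections; [exact: (@scale_mull k A) | exact: (@mulrA k)].
Qed.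

Definition adjoin_point : fdAlgType k :=
  FdAlgType adj_mulA adj_mulC adj_mul1 adj_mulDl adj_scaleAl.

Lemma adjoin_point_dim : \dim {:adjoin_point} = (\dim {:A}).+1.
Proof. by rewrite !dimvf [RHS]/= -addn1. Qed.

End AdjoinPoint.

(** * Changing the algebra of a presentation *)

Section ChangeOfAlgebra.
Variables (k : fieldType) (d : nat) (V : 'I_d -> vectType k).
Implicit Types (T : covectors V -> k).

(** The added point is sent to an arbitrary point (v_1, ..., v_d) of Seg, and the
new functional ignores it, so T is unchanged. *)
Lemma adjoin_point_presents (A : fdAlgType k) (l : sections A V) eps T :
    (forall i, (0 < \dim {:V i})%N) -> presents l eps T ->
  exists (l' : sections (adjoin_point A) V) eps', presents l' eps' T.
Proof.
move=> V_gt0 [uni TE].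
have pt i : exists p : V i * dual k (V i), p.2 p.1 = 1.
  have vnz : vpick {:V i} != 0 by rewrite vpick0 -dimv_eq0 -lt0n.
  have [alpha av] : exists alpha : dual k (V i), alpha (vpick {:V i}) != 0.
    apply: contrapT => no; case/eqP: vnz; apply: dual_separates => alpha.
    by apply/eqP; apply: contrapT => /negP nz; apply: no; exists alpha.
  exists (vpick {:V i}, (alpha (vpick {:V i}))^-1 *: alpha).
  by rewrite scale_lfunE; apply: mulVf.
pose v i := (projT1 (cid (pt i))).1; pose beta i := (projT1 (cid (pt i))).2.
have bv i : beta i (v i) = 1 by rewrite /beta /v; case: cid.
have lin i : linear (fun al : dual k (V i) => (l i al, al (v i)) : adjoin_point A).
  move=> c x y; apply: injective_projections; first by rewrite linearP.
  by rewrite /= add_lfunE scale_lfunE.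
pose l' i : 'Hom(dual k (V i), adjoin_point A) :=
  linfun (fun al : dual k (V i) => (l i al, al (v i)) : adjoin_point A).
have l'E i al : l' i al = (l i al, al (v i)) by rewrite linear_linfunE //; exact: lin.
have lin_eps : linear (fun x : adjoin_point A => eps x.1 : k^o).
  by move=> c x y; rewrite [LHS]lfunD lfunZ.
exists l', (linfun (fun x : adjoin_point A => eps x.1 : k^o)); split=> [i|alpha].
  have [s s1] := uni i.
  exists (((0, 1) : adjoin_point A, beta i) ::
          [seq ((p.1, 0) : adjoin_point A, p.2) | p <- s]).
  rewrite big_cons big_map /= l'E bv.
  have -> : \sum_(p <- s) ((p.1, 0) : adjoin_point A) * l' i p.2 =
            ((\sum_(p <- s) p.1 * l i p.2, 0) : adjoin_point A).
    elim: s {s1} => [|p s IHs]; first by rewrite !big_nil.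
    rewrite !big_cons IHs l'E.
    apply: injective_projections; first by [].
    by rewrite /= mul0r addr0.
  rewrite s1; apply: injective_projections; rewrite /=.
    by rewrite mul0r add0r.
  by rewrite mulr1 addr0.
rewrite TE (linear_linfunE lin_eps); congr (eps _).
rewrite /segre; elim/big_rec2: _ => // i x y _ ->.
by rewrite l'E.
Qed.

Lemma presents_pad (A : fdAlgType k) (l : sections A V) eps T r :
    (forall i, (0 < \dim {:V i})%N) -> presents l eps T -> (\dim {:A} <= r)%N ->
  exists (A' : fdAlgType k) (l' : sections A' V) eps',
    \dim {:A'} = r /\ presents l' eps' T.
Proof.
move=> V_gt0 presT /subnKC <-; move: (r - _)%N => n.
elim: n A l eps presT => [|n IHn] A l eps presT.
  by rewrite addn0; exists A, l, eps.
have [l1 [eps1 pres1]] := adjoin_point_presents V_gt0 presT.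
by rewrite addnS -addSn -adjoin_point_dim; apply: (IHn _ _ _ pres1).
Qed.

Lemma presents_gorenstein_quotient (A : fdAlgType k) (l : sections A V) eps T :
    presents l eps T ->
  exists (A' : fdAlgType k) (pi : 'Hom(A, A')) (l' : sections A' V) eps',
  [/\ [/\ pi 1 = 1, (forall x y, pi (x * y) = pi x * pi y)
        & (forall y, exists x, pi x = y)],
      dual_generator eps', (forall x, eps' (pi x) = eps x)
    & presents l' eps' T].
Proof.
move=> [uni TE]; have [A' [pi [eps' [pi1 piM pi_surj gen' eps'E]]]] := gorenstein_quotient eps.
exists A', pi, (fun i => (pi \o l i)%VF), eps'; split=> //; split=> [i|alpha].
  have [s s1] := uni i; exists [seq (pi p.1, p.2) | p <- s].
  rewrite big_map -pi1 -s1 lfun_sum; apply: eq_bigr => p _.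
  by rewrite comp_lfunE piM.
rewrite TE -eps'E; congr (eps' _); rewrite /segre.
by elim/big_rec2: _ => // i x y _ IH; rewrite piM comp_lfunE -IH.
Qed.

Lemma regular_unimodular (A : fdAlgType k) (W : vectType k)
    (phi : 'Hom(dual k A, W)) (l : 'Hom(dual k W, A)) :
  (forall v, dual_map phi v = l v) -> regular_map phi <-> unimodular l.
Proof.
move=> phiE; split=> [/(_ 1)[m [a [v s1]]]|[s s1] x].
  exists [seq (a t, v t) | t <- index_enum 'I_m].
  by rewrite big_map s1; apply: eq_bigr => t _; rewrite phiE.
exists (size s), (fun t => x * (tnth (in_tuple s) t).1), (fun t => (tnth (in_tuple s) t).2).
rewrite -[LHS]mulr1 -s1 big_tnth mulr_sumr; apply: eq_bigr => t _.
by rewrite phiE mulrA.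
Qed.

(** The maps phi_i : A^v -> V_i and l_i : V_i^v -> A determine each other by
transposition, and pulling back (a_1, ..., a_d) |-> eps(a_1 ... a_d) along the l_i is
the same as restricting it via the phi_i. *)
Lemma gorenstein_regular_restrictionP (A : fdAlgType k) T :
  gorenstein_regular_restriction A T <->
  exists (l : sections A V) eps, dual_generator eps /\ presents l eps T.
Proof.
have formE (phi : forall i, 'Hom(dual k A, V i)) (l : sections A V) eps alpha :
    (forall i v, dual_map (phi i) v = l i v) ->
  tensor_map phi (gorenstein_tensor eps) alpha = eps (segre l alpha).
  by move=> phiE; congr (eps _); apply: eq_bigr => i _; rewrite -phiE.
split=> [[eps [phi [gen reg TE]]]|[l [eps [gen [uni TE]]]]].
  have lin i : linear (dual_map (phi i)).
    move=> c x y; rewrite /dual_map -linearP; congr (unbidual A _).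
    by rewrite comp_lfunDl comp_lfunZl.
  pose l i := linfun (dual_map (phi i)).
  have phiE i v : dual_map (phi i) v = l i v by rewrite linear_linfunE //; exact: lin.
  exists l, eps; split=> //; split=> [i|alpha]; last by rewrite -TE (formE _ l).
  exact/(regular_unimodular (phiE i)).
have ex i := ex_transpose (bidual A \o l i)%VF.
pose phi i := projT1 (cid (ex i)).
have phiE i v : dual_map (phi i) v = l i v.
  rewrite /phi /dual_map; case: cid => f [fE _] /=.
  by rewrite fE comp_lfunE bidualK.
exists eps, phi; split=> // [i|alpha]; first exact/(regular_unimodular (phiE i)).
by rewrite (formE _ l) // TE.
Qed.

End ChangeOfAlgebra.

(** * Conciseness *)

Section Concise.
Variables (k : fieldType) (d : nat) (V : 'I_d -> vectType k).
Variables (A : fdAlgType k) (l : sections A V) (eps : dual k A) (T : covectors V -> k).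

(** For xi in A^v the composite xi o l_i is an element of V_i^vv = V_i, a slice of
l_i in V_i (x) A.  Expanding every l_i in a basis of A writes T as a sum of pure
tensors in these slices; the index i0 is a place to put the scalar
coefficients. *)
Lemma presents_in_subtensor (V' : forall i, {vspace V i}) (i0 : 'I_d) :
    (forall alpha, T alpha = eps (segre l alpha)) ->
    (forall i (xi : dual k A), exists2 v, v \in V' i &
       forall alpha : dual k (V i), alpha v = xi (l i alpha)) ->
  in_subtensor V' T.
Proof.
move=> TE slices.
pose n := \dim {:A}; pose b (s : 'I_n) : A := (vbasis {:A})`_s.
have pickv i (s : 'I_n) : exists v, v \in V' i /\
    forall alpha : dual k (V i), alpha v = coord (vbasis {:A}) s (l i alpha).
  have [v vV' vE] := slices i (linfun (coord (vbasis {:A}) s : A -> k^o)).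
  exists v; split=> // alpha.
  by rewrite vE linear_linfunE //; exact: linear_coord.
pose v i s := projT1 (cid (pickv i s)).
have vV' i s : v i s \in V' i by rewrite /v; case: cid => ? [].
have vE i s (alpha : dual k (V i)) : alpha (v i s) = coord (vbasis {:A}) s (l i alpha).
  by rewrite /v; case: cid => ? [].
pose F := {ffun 'I_d -> 'I_n}.
pose c (f : F) := eps (\prod_i b (f i)).
pose w (t : 'I_#|F|) i : V i :=
  let f := enum_val t in if i == i0 then c f *: v i (f i) else v i (f i).
exists #|F|, w; split=> [t i|alpha].
  by rewrite /w; case: ifP => _; rewrite ?memvZ.
rewrite TE; have -> : segre l alpha = \sum_(f : F) (\prod_i alpha i (v i (f i))) *: \prod_i b (f i).
  rewrite /segre; transitivity (\prod_(i < d) (\sum_(s : 'I_n) alpha i (v i s) *: b s : A)).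
    apply: eq_bigr => i _; rewrite [LHS]coord_vbasisE.
    by apply: eq_bigr => s _; rewrite vE.
  rewrite bigA_distr_bigA; apply: eq_bigr => f _.
  elim/big_rec3: _ => [|i x y z _ ->]; first by rewrite scale1r.
  by rewrite /= -scale_mull -scale_mulr scalerA.
rewrite lfun_sum (reindex (@enum_val F predT)) /=; last first.
  by apply: onW_bij; exact: enum_val_bij.
apply: eq_bigr => t _.
set f := enum_val t; rewrite lfunZ /pure_tensor (bigD1 i0) //= [RHS](bigD1 i0) //=.
have -> : \prod_(i | i != i0) alpha i (w t i) = \prod_(i | i != i0) alpha i (v i (f i)).
  by apply: eq_bigr => i /negPf ne_i; rewrite /w ne_i.
rewrite /w eqxx lfunZ -/f -/(c f) -[LHS]/(_ * _ * c f) -[c f *: _]/(c f * _).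
by rewrite mulrC mulrA.
Qed.

(** If l_i0 kills a covector beta, then all slices of l_i0 lie in ker beta, so T
involves only the subspace ker beta of V_i0. *)
Lemma concise_injective : concise T ->
  (forall alpha, T alpha = eps (segre l alpha)) -> forall i, injective (l i).
Proof.
move=> conT TE i0 x y exy; apply/eqP; rewrite -subr_eq0; apply/eqP.
set beta := x - y; have lb : l i0 beta = 0 by rewrite lfunB exy subrr.
pose V' : forall i, {vspace V i} :=
  dfwith (fun i => fullv : {vspace V i}) (lker beta).
have subT : in_subtensor V' T.
  apply: (presents_in_subtensor i0) => // i xi.
  have [f [fE _]] := ex_transpose (bidual A \o l i)%VF.
  have : forall alpha : dual k (V i), alpha (f xi) = xi (l i alpha).
    by move=> alpha; rewrite -comp_lfunE fE comp_lfunE bidualE.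
  move: (f xi) => u uE; exists u => //; move: u uE.
  rewrite /V'; case: dfwithP => [|j _] u uE; last exact: memvf.
  by rewrite memv_ker uE lb lfun0.
have := conT V' subT i0; rewrite /V' dfwith_in => kerb.
by apply/lfunP => v; rewrite zero_lfunE; apply/eqP; rewrite -memv_ker kerb memvf.
Qed.

End Concise.

(** * Reduction to closed immersions *)

Section ClosedImmersion.
Variables (k : fieldType) (A : fdAlgType k) (d : nat) (V : 'I_d -> vectType k).
Variable l : sections A V.

(** The values at l of the multihomogeneous forms of multidegree (N, ..., N): the
degree N part of the image in A of the homogeneous coordinate ring of Seg. *)
Definition is_form (N : nat) (x : A) : Prop :=
  exists s : seq (k * ('I_N -> covectors V)),
    x = \sum_(p <- s) p.1 *: \prod_j segre l (p.2 j).

Lemma is_form0 N : is_form N 0.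
Proof. by exists [::]; rewrite big_nil. Qed.

Lemma is_form_lin N c x y : is_form N x -> is_form N y -> is_form N (c *: x + y).
Proof.
move=> [s ->] [t ->]; exists ([seq (c * p.1, p.2) | p <- s] ++ t).
rewrite big_cat big_map /= scaler_sumr; congr (_ + _).
by apply: eq_bigr => p _; rewrite scalerA.
Qed.

Lemma is_formM N M x y : is_form N x -> is_form M y -> is_form (N + M) (x * y).
Proof.
move=> [s ->] [t ->].
pose cat_form (F : 'I_N -> covectors V) (G : 'I_M -> covectors V) (j : 'I_(N + M)) :=
  match split j with inl a => F a | inr b => G b end.
exists [seq (p.1 * q.1, cat_form p.2 q.2) | p <- s, q <- t].
rewrite big_allpairs_dep /= big_distrlr /=.
apply: eq_bigr => p _; apply: eq_bigr => q _.
rewrite -scale_mull -scale_mulr scalerA; congr (_ *: _).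
rewrite big_split_ord /=; congr (_ * _); apply: eq_bigr => j _; rewrite /cat_form.
  by rewrite -[lshift _ _]/(unsplit (inl j)) unsplitK.
by rewrite -[rshift _ _]/(unsplit (inr j)) unsplitK.
Qed.

Lemma is_form_segre_exp beta N : is_form N (segre l beta ^+ N).
Proof.
exists [:: (1, fun=> beta)].
by rewrite big_seq1 scale1r /= prodr_const card_ord.
Qed.

(** The element a comes from a regular function F / segre(beta)^N on the chart
S_beta, at least on the part of Spec A that lies over it: on the rest, segre(beta)
is nilpotent and the condition says nothing for large N. *)
Definition regular_at (beta : covectors V) (a : A) : Prop :=
  exists N, is_form N (segre l beta ^+ N * a).

Lemma regular_at_lin beta c x y :
  regular_at beta x -> regular_at beta y -> regular_at beta (c *: x + y).
Proof.
move=> [N Nx] [M My]; exists (N + M)%N; rewrite mulrDr -scale_mulr.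
apply: is_form_lin.
  by rewrite exprD mulrAC; apply: is_formM => //; apply: is_form_segre_exp.
by rewrite exprD -mulrA; apply: is_formM => //; apply: is_form_segre_exp.
Qed.

Lemma regular_atM beta x y :
  regular_at beta x -> regular_at beta y -> regular_at beta (x * y).
Proof.
move=> [N Nx] [M My]; exists (N + M)%N.
by rewrite exprD mulrACA; apply: is_formM.
Qed.

Lemma regular_at_closed_immersion (L : line_family A V) :
    (forall i, generates (L i) (l i)) -> (forall beta a, regular_at beta a) ->
  is_closed_immersion L.
Proof.
move=> genl reg beta a; have [N [s sE]] := reg beta a.
exists N, (size s), (fun t => (tnth (in_tuple s) t).1), (fun t => (tnth (in_tuple s) t).2).
move=> l' /(section_scalars genl)[c l'E].
rewrite l'E exprMn -mulrA sE big_tnth mulr_sumr; apply: eq_bigr => t _.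
rewrite -scale_mulr; congr (_ *: _).
under [RHS]eq_bigr => j _ do rewrite l'E.
by rewrite big_split prodr_const card_ord.
Qed.

(** The elements regular at beta form a subalgebra U.  Fitting's idempotent e of
s = segre(beta) cuts out the preimage of the chart S_beta; there each l_i(beta_i)
is invertible, and u_i rescales l_i so that u_i l_i(beta_i) = 1, while u_i = 1 on
the complement.  The rescaled coordinates u_i l_i(alpha) are
segre(beta with alpha at i) / segre(beta) over the chart, hence lie in U, and (1 - e)A
is contained in U.  The units u_i are absorbed into eps. *)
Lemma presents_subalgebra eps T beta a0 :
    presents l eps T -> ~ regular_at beta a0 ->
  exists (B : fdAlgType k) (l' : sections B V) eps',
    (\dim {:B} < \dim {:A})%N /\ presents l' eps' T.
Proof.
move=> [uni TE] nreg; set s := segre l beta.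
have [|U UP] := ex_vspace_of_pred _ (@regular_at_lin beta).
  by exists 0%N; rewrite mulr0; apply: is_form0.
have U1 : 1 \in U by apply/UP; exists 0%N; rewrite mulr1; apply: is_form_segre_exp.
have UM (x y : A) : x \in U -> y \in U -> x * y \in U.
  by move=> /UP xU /UP yU; apply/UP/regular_atM.
have [e [w [n [ee ew se]]]] := fitting_idempotent s.
(* On eA the element m_i w is inverse to l_i(beta_i), since
   l_i(beta_i) m_i w = s w = e. *)
pose m i := \prod_(j < d | j != i) l j (beta j).
have sE i : s = l i (beta i) * m i by rewrite /s /segre (bigD1 i).
pose u i := e * (m i * w) + (1 - e); pose v i := e * l i (beta i) + (1 - e).
have e1e : e * (1 - e) = 0 by rewrite mulrBr mulr1 ee subrr.
have eu i : e * u i * l i (beta i) = e.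
  have -> : e * u i * l i (beta i) =
    e * e * ((l i (beta i) * m i) * w) + e * (1 - e) * l i (beta i).
    by rewrite /u; ring.
  by rewrite e1e mul0r addr0 -sE -ew !ee.
have neu i : (1 - e) * u i = 1 - e.
  have -> : (1 - e) * u i = e * (1 - e) * (m i * w) + (1 - e) - e * (1 - e).
    by rewrite /u; ring.
  by rewrite e1e mul0r add0r subr0.
have uv i : u i * v i = 1.
  have -> : u i * v i = e * u i * l i (beta i) + (1 - e) * u i by rewrite /v; ring.
  by rewrite eu neu addrC subrK.
(* s^n (1 - e) = 0, so both e and every (1 - e) x are regular at beta. *)
have eU : e \in U.
  by apply/UP; exists n; rewrite se; apply: is_form_segre_exp.
have neU x : (1 - e) * x \in U.
  apply/UP; exists n; rewrite mulrA mulrBr mulr1 se subrr mul0r; apply: is_form0.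
have uU i alpha : u i * l i alpha \in U.
  apply/UP; exists n.+1; rewrite -/s.
  have -> : s ^+ n.+1 * (u i * l i alpha) = segre l (dfwith beta alpha) * s ^+ n.
    rewrite segre_dfwith -/(m i) exprSr -se.
    have -> : s ^+ n * e * s * (u i * l i alpha) = s ^+ n * s * l i alpha * (e * u i).
      by ring.
    have -> : s ^+ n * s * l i alpha * (e * u i) =
       s ^+ n * m i * l i alpha * (e * u i * l i (beta i)).
      by rewrite {2}(sE i); ring.
    by rewrite eu; ring.
  rewrite -add1n; apply: is_formM; last exact: is_form_segre_exp.
  by rewrite -[segre _ _]expr1; apply: is_form_segre_exp.
pose B := subalg U1 UM.
have lin i : linear (fun alpha : dual k (V i) => (vsproj U (u i * l i alpha) : B)).
  by move=> c x y; rewrite lfunD lfunZ mulrDr -scale_mulr linearP.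
pose l' i : 'Hom(dual k (V i), B) :=
  linfun (fun alpha : dual k (V i) => (vsproj U (u i * l i alpha) : B)).
have l'E i alpha : vsval (l' i alpha : subvs_of U) = u i * l i alpha.
  by rewrite (linear_linfunE (lin i)) vsprojK.
have valM (x y : B) : vsval (x * y : subvs_of U) =
    (vsval (x : subvs_of U) : A) * vsval (y : subvs_of U).
  exact: (sub_mulE UM).
have val1 : vsval ((1 : B) : subvs_of U) = 1 by rewrite vsprojK.
have lin_eps : linear (fun b : B => eps (\prod_i v i * vsval (b : subvs_of U)) : k^o).
  by move=> c x y; rewrite linearP mulrDr -scale_mulr lfunD lfunZ.
exists B, l', (linfun (fun b : B => eps (\prod_i v i * vsval (b : subvs_of U)) : k^o)).
split.
  have -> : \dim {:B} = \dim U by rewrite dimvf.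
  rewrite (ltn_leqif (dimv_leqif_eq (subvf U))); apply: contra_notN nreg => /eqP Uf.
  by apply/UP; rewrite Uf memvf.
split=> [i|alpha].
  have [r r1] := uni i.
  exists ((vsproj U e : B, beta i) :: [seq (vsproj U ((1 - e) * p.1) : B, p.2) | p <- r]).
  apply: subvs_inj; rewrite val1 big_cons big_map linearD linear_sum /=.
  rewrite valM l'E vsprojK // mulrA eu.
  have -> : \sum_(p <- r) vsval (((vsproj U ((1 - e) * p.1) : B) * l' i p.2) : subvs_of U)
     = (1 - e) * \sum_(p <- r) p.1 * l i p.2.
    rewrite mulr_sumr; apply: eq_bigr => p _.
    by rewrite valM l'E vsprojK // -[in RHS](neu i); ring.
  by rewrite r1 mulr1 addrC subrK.
rewrite TE (linear_linfunE lin_eps); congr (eps _).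
have -> : vsval (segre l' alpha : subvs_of U) = \prod_i (u i * l i (alpha i)).
  rewrite /segre; elim/big_rec2: _ => // i x y _ IH.
  by rewrite -IH valM l'E.
rewrite -big_split; apply: eq_bigr => i _ /=.
by rewrite mulrA [v i * _]mulrC uv mul1r.
Qed.

End ClosedImmersion.

Lemma ex_closed_presentation (k : fieldType) (d : nat) (V : 'I_d -> vectType k)
    (T : covectors V -> k) (A : fdAlgType k) (l : sections A V) eps :
    presents l eps T ->
  exists (A' : fdAlgType k) (L : line_family A' V),
    [/\ is_morphism L, is_closed_immersion L, (\dim {:A'} <= \dim {:A})%N
      & in_span L T].
Proof.
have [n] := ubnP (\dim {:A}); elim: n A l eps => // n IHn A l eps ltn presT.
have [L [morL genl spanT]] := span_of_presents presT.
have [reg|nreg] := pselect (forall beta a, regular_at l beta a).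
  by exists A, L; split=> //; apply: (regular_at_closed_immersion genl).
have [beta [a nreg_a]] : exists beta a, ~ regular_at l beta a.
  by move/existsNP: nreg => [beta /existsNP[a na]]; exists beta, a.
have [B [l' [eps' [ltB presB]]]] := presents_subalgebra presT nreg_a.
have [|A' [L' [morL' clL' leB spanL']]] := IHn B l' eps' _ presB.
  exact: leq_trans ltB ltn.
by exists A', L'; split=> //; apply: leq_trans leB (ltnW ltB).
Qed.

(** * Concise tensors and the multiplication tensor *)

Section ConciseCase.
Variable k : fieldType.

Variables (A : fdAlgType k) (eps : dual k A).

Lemma trace_form_bij : dual_generator eps -> bijective (trace_form eps).
Proof.
by move=> /dual_generator_nondegenerate; apply: nondegenerate_trace_form_bij.
Qed.

(** The identification of a coordinate space of the multiplication tensor,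
dualised, with A: at the last place it inverts A -> A^v, a |-> a.eps, and elsewhere
it is reflexivity A^vv = A.  It is stated for an abstract boolean because the
coordinate space depends on one. *)
Definition mul_coord (b : bool) :
    'Hom(dual k (if b then A : vectType k else dual k A), A) :=
  if b return 'Hom(dual k (if b then A : vectType k else dual k A), A)
  then (trace_form eps)^-1%VF else unbidual A.

Lemma mul_coord_bij b : dual_generator eps -> bijective (mul_coord b).
Proof.
move=> /trace_form_bij bij_tr; case: b => /=.
  by have [trK Ktr] := inv_lfun_bij bij_tr; exists (trace_form eps).
by exists (bidual A); [exact: unbidualK | exact: bidualK].
Qed.

Lemma mul_outE b (y : dual k (if b then A : vectType k else dual k A)) z :
  dual_generator eps -> b -> mul_out y z = eps (mul_coord b y * z).
Proof.
move=> /trace_form_bij bij_tr; case: b y => //= y _.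
by have [_ Ktr] := inv_lfun_bij bij_tr; rewrite -trace_formE Ktr.
Qed.

Lemma mul_arg_last b (y : dual k (if b then A : vectType k else dual k A)) :
  b -> mul_arg y = 1.
Proof. by case: b y. Qed.

Lemma mul_arg_other b (y : dual k (if b then A : vectType k else dual k A)) :
  ~~ b -> mul_arg y = mul_coord b y.
Proof. by case: b y. Qed.

Variables (d : nat) (V : 'I_d -> vectType k) (T : covectors V -> k).

Lemma mul_tensorE (last : 'I_d) x : dual_generator eps ->
  mul_tensor (A := A) (last := last) x = eps (\prod_i mul_coord (i == last) (x i)).
Proof.
move=> gen; rewrite /mul_tensor (mul_outE _ _ gen) // (bigD1 last) //= mul_arg_last // mul1r.
rewrite [in RHS](bigD1 last) //=; congr (eps (_ * _)).
by apply: eq_bigr => i ne_i; exact: mul_arg_other.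
Qed.

(** The isomorphism V_i -> W_i onto the i-th coordinate space is the transpose of
l_i^(-1) o mul_coord : W_i^v -> A -> V_i^v. *)
Lemma tensor_iso_mul_tensor (l : sections A V) (last : 'I_d) :
    dual_generator eps -> (forall i, bijective (l i)) ->
    (forall alpha, T alpha = eps (segre l alpha)) ->
  tensor_iso T (mul_tensor (A := A) (last := last)).
Proof.
move=> gen bij_l TE.
pose h i : 'Hom(dual k (mul_space A last i), dual k (V i)) :=
  ((l i)^-1 \o mul_coord (i == last))%VF.
have ex i := ex_transpose (h i).
exists (fun i => projT1 (cid (ex i))); split=> [i|alpha].
  case: cid => f [_ bij_f] /=; apply: bij_f.
  have [lK Kl] := inv_lfun_bij (bij_l i).
  apply: (@eq_bij _ _ ((l i)^-1%VF \o mul_coord (i == last))); last first.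
    by move=> x; rewrite /h comp_lfunE.
  by apply: bij_comp; [exists (l i) | exact: mul_coord_bij].
rewrite mul_tensorE // /tensor_map TE; congr (eps _); apply: eq_bigr => i _.
case: cid => f [fE _] /=; rewrite fE comp_lfunE.
by have [_ ->] := inv_lfun_bij (bij_l i).
Qed.

(** By conciseness V_i0^v embeds into the Gorenstein quotient A' of A, so
dim A' >= dim A and A' = A. *)
Lemma concise_dual_generator (l : sections A V) (i0 : 'I_d) :
    presents l eps T -> concise T -> (\dim {:A} <= \dim {:V i0})%N ->
  dual_generator eps.
Proof.
move=> presT conT leAV.
have [A' [pi [l' [eps' [[pi1 piM pi_surj] gen' eps'E presT']]]]] :=
  presents_gorenstein_quotient presT.
have inj_l' := concise_injective conT presT'.2 (i := i0).
have inj_pi : injective pi.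
  apply: surj_lfun_inj => //; apply: leq_trans leAV _.
  rewrite -(dual_dim (V i0)) -(@limg_dim_eq _ _ _ (l' i0)).
    exact: dimvS (subvf _).
  by rewrite (eqP (introT lker0P inj_l')) capv0.
apply: nondegenerate_dual_generator => a a0; apply: inj_pi; rewrite lfun0.
apply: (dual_generator_nondegenerate gen') => y.
by have [x <-] := pi_surj y; rewrite -piM eps'E.
Qed.

End ConciseCase.

(** * The characterisation of cactus rank *)

Theorem theorem1p3 (k : fieldType) (d : nat) (hd : (3 <= d)%N)
    (V : 'I_d -> vectType k) (hV : forall i, (0 < \dim (fullv : {vspace V i}))%N)
    (T : covectors V -> k) (hT : multilinear T) (r : nat) (hr : (1 <= r)%N) :
  let a := cactus_rank_le T r in
  let b := exists (A : fdAlgType k) (L : line_family A V),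
    [/\ \dim (fullv : {vspace A}) = r, is_morphism L & in_span L T] in
  let c := exists A' : fdAlgType k,
    (\dim (fullv : {vspace A'}) <= r)%N /\ gorenstein_regular_restriction A' T in
  [/\ a <-> b,
      b <-> c
    & forall (A : fdAlgType k) (L : line_family A V),
        \dim (fullv : {vspace A}) = r -> is_morphism L -> in_span L T ->
        (exists A' : fdAlgType k,
           [/\ is_quotient_algebra A A',
               (\dim (fullv : {vspace A'}) <= r)%N
             & gorenstein_regular_restriction A' T])
        /\
        ((forall i, \dim (fullv : {vspace V i}) = r) -> concise T ->
         (forall last : 'I_d, last.+1 = d ->
            tensor_iso T (mul_tensor (A := A) (d := d) (last := last)))
         /\ gorenstein A)].
Proof.
have pad (A : fdAlgType k) (l : sections A V) eps :
    presents l eps T -> (\dim {:A} <= r)%N ->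
  exists (A' : fdAlgType k) (L : line_family A' V),
    [/\ \dim {:A'} = r, is_morphism L & in_span L T].
  move=> presT leA; have [A' [l' [eps' [dimA' presT']]]] := presents_pad hV presT leA.
  by have [L [morL _ spanT]] := span_of_presents presT'; exists A', L.
have quot (A : fdAlgType k) (L : line_family A V) :
    \dim {:A} = r -> is_morphism L -> in_span L T ->
  exists A' : fdAlgType k, [/\ is_quotient_algebra A A', (\dim {:A'} <= r)%N
    & gorenstein_regular_restriction A' T].
  move=> dimA morL spanT; have [l [eps presT]] := presents_of_span morL spanT.
  have [A' [pi [l' [eps' [[pi1 piM pi_surj] gen' _ presT']]]]] :=
    presents_gorenstein_quotient presT.
  exists A'; split; first by exists pi.
    rewrite -dimA -(surj_lfun_dim pi_surj) -[leqRHS](limg_ker_dim pi).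
    exact: leq_addl.
  by apply/gorenstein_regular_restrictionP; exists l', eps'.
split.
- split=> [[A [L [morL _ leA spanT]]]|[A [L [dimA morL spanT]]]].
    by have [l [eps presT]] := presents_of_span morL spanT; apply: pad presT leA.
  have [l [eps presT]] := presents_of_span morL spanT.
  have [A' [L' [morL' clL' leA' spanL']]] := ex_closed_presentation presT.
  by exists A', L'; split=> //; rewrite -dimA.
- split=> [[A [L [dimA morL spanT]]]|[A [leA /gorenstein_regular_restrictionP]]].
    by have [A' [_ leA' resT]] := quot A L dimA morL spanT; exists A'.
  by move=> [l [eps [_ presT]]]; apply: pad presT leA.
move=> A L dimA morL spanT; split; first exact: quot spanT.
move=> dimV conT; have [l [eps presT]] := presents_of_span morL spanT.
have gen : dual_generator eps.
  pose i0 : 'I_d := Ordinal (leq_trans (isT : (0 < 3)%N) hd).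
  by apply: (concise_dual_generator (i0 := i0) presT conT); rewrite dimA dimV.
split; last by exists eps.
move=> last _; apply: (tensor_iso_mul_tensor last gen _ presT.2) => i.
apply: inj_lfun_bij; first exact: concise_injective conT presT.2 _.
by rewrite dual_dim dimA dimV.
Qed.
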